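(* Let $X=\{0,1,\ldots,K\}$. The vector $(p_0,p_1,\ldots,p_K)$ of frequencies is computable with infinite memory; that is, the function family $(f_n)_{n=1,2,\ldots}$ given by $f_n(x_1,\ldots,x_n)=\big(p_0(x_1,\ldots,x_n),\ldots,p_K(x_1,\ldots,x_n)\big)$, where $p_k(x_1,\ldots,x_n)=|\{i:x_i=k\}|/n$, is computable with infinite memory.
   Context: Model of computation. $X$ is the finite input set and $Y$ the output set (here a countable set containing all possible frequency vectors). A network is a triple $(n,G,\mathcal L)$ where $n\ge 2$ is the number of nodes, $G=(V,E)$ is a connected bidirectional graph on $V=\{1,\ldots,n\}$ (a directed graph without self-loops such that $(i,j)\in E$ implies $(j,i)\in E$), $d(i)$ is the degree of node $i$ (its in-degree, equal to its out-degree), and $\mathcal L$ is a port labeling: it assigns to the outgoing edges of each node $i$ distinct integers (port numbers) from $\{0,1,\ldots,d(i)\}$. An algorithm is a family of automata $(A_d)_{d=1,2,\ldots}$. A state of $A_d$ is a tuple $[x,z,y;(m_1,\ldots,m_d)]$ with $x\in X$ (initial value), $z\in Z_d$ (internal memory state), $y\in Y$ (output), $m_1,\ldots,m_d\in M$ (outgoing messages). The sets $Y,Z_d,M$ in the state space are assumed to contain a special symbol $\emptyset$ (adjoined if necessary). $A_d$ is identified with a map from $X\times Z_d\times Y\times M^d$ to itself that does not change $x$. Execution: given initial values $x_1,\ldots,x_n\in X$, node $i$ runs $A_{d(i)}$ started at time $0$ with $x=x_i$ and $z=y=m_1=\cdots=m_{d(i)}=\emptyset$. At each node, order the outgoing edges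 by increasing port number. Let $j_k$ be the node at the other end of the $k$th outgoing edge of $i$, and let $p_k$ (in this paragraph) be the position of the edge $(j_k,i)$ in the ordering at $j_k$. For $t=0,1,2,\ldots$ all nodes simultaneously update $$[x_i,z_i(t+1),y_i(t+1);m_{i,1}(t+1),\ldots,m_{i,d(i)}(t+1)]=A_{d(i)}[x_i,z_i(t),y_i(t);m_{j_1,p_1}(t),\ldots,m_{j_{d(i)},p_{d(i)}}(t)].$$ The algorithm terminates with final output $y^*\in Y$ if there is a time $t'$ with $y_i(t)=y^*$ for all nodes $i$ and all $t\ge t'$. A family $(f_n)$, $f_n:X^n\to Y$, is computable with infinite memory if there is an algorithm $(A_d)$ (not depending on $n$ or the network), with $M$ finite and with $Y$ and the $Z_d$ allowed to be countably infinite, such that for every $n$, every network $(n,G,\mathcal L)$ and all initial values $x_1,\ldots,x_n\in X$ the algorithm terminates with final output $f_n(x_1,\ldots,x_n)$. *)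

(* Defs.v *)
From HB Require Import structures.
From mathcomp Require Import all_boot all_order all_algebra.

Set Implicit Arguments.
Unset Strict Implicit.
Unset Printing Implicit Defensive.

(* The nodes {1, .., n} are the elements of 'I_n.  A bidirectional graph is a
   symmetric relation, so the in-degree and the out-degree coincide. *)
Definition degree (n : nat) (e : rel 'I_n) (i : 'I_n) : nat :=
  #|[pred j | e i j]|.

(* [port i j] is the label of the edge (i, j); its value is irrelevant when
   (i, j) is not an edge. *)
Record network (n : nat) : Type := Network {
  edge : rel 'I_n;
  port : 'I_n -> 'I_n -> nat;
  network_size : 2 <= n;
  edge_irreflexive : irreflexive edge;
  edge_symmetric : symmetric edge;
  edge_connected : forall i j : 'I_n, connect edge i j;
  port_bound : forall i j : 'I_n, edge i j -> port i j <= degree edge i;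
  port_inj : forall i j k : 'I_n,
    edge i j -> edge i k -> port i j = port i k -> j = k
}.

Definition deg (n : nat) (N : network n) (i : 'I_n) : nat := degree (edge N) i.

Definition neighbors (n : nat) (N : network n) (i : 'I_n) :
    (deg N i).-tuple 'I_n :=
  [tuple of sort (fun j k => port N i j <= port N i k)
                 (enum_tuple [pred j | edge N i j])].

Definition position (n : nat) (N : network n) (j i : 'I_n) : nat :=
  index i (neighbors N j).

Lemma neighbor_edge (n : nat) (N : network n) (i j : 'I_n) :
  (j \in neighbors N i) = edge N i j.
Proof. by rewrite mem_sort mem_enum. Qed.

Lemma position_lt (n : nat) (N : network n) (i : 'I_n) (k : 'I_(deg N i)) :
  position N (tnth (neighbors N i) k) i < deg N (tnth (neighbors N i) k).
Proof.
rewrite -[X in _ < X](size_tuple (neighbors N (tnth (neighbors N i) k))).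
by rewrite index_mem neighbor_edge edge_symmetric -neighbor_edge mem_tnth.
Qed.

(* The special symbol is adjoined to the sets of memory states, outputs and
   messages, in the form of [None]. *)
Record state (X Z Y M : Type) (d : nat) : Type := State {
  input : X;
  memory : option Z;
  output : option Y;
  messages : d.-tuple (option M)
}.

(* [countType] covers both finite and countably infinite types.  The automaton
   of index 0 is never run, as all degrees in a network are positive. *)
Record algorithm (X : finType) (Y : countType) : Type := Algorithm {
  Zset : nat -> countType;
  Mset : finType;
  automaton : forall d : nat,
    state X (Zset d) Y Mset d -> state X (Zset d) Y Mset d;
  automaton_input : forall (d : nat) (s : state X (Zset d) Y Mset d),
    input (automaton s) = input s
}.

(* The state at time t of every node.  The default value of [nth] is never used,
   by [position_lt]. *)
Fixpoint execution (X : finType) (Y : countType) (A : algorithm X Y)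
    (n : nat) (N : network n) (x : (X ^ n)%type) (t : nat) (i : 'I_n) :
    state X (Zset A (deg N i)) Y (Mset A) (deg N i) :=
  if t is t'.+1 then
    let S := execution A N x t' in
    automaton (State (x i) (memory (S i)) (output (S i))
      [tuple nth None (messages (S (tnth (neighbors N i) k)))
                      (position N (tnth (neighbors N i) k) i)
       | k < deg N i])
  else State (x i) None None [tuple None | k < deg N i].

Definition terminates_with (X : finType) (Y : countType) (A : algorithm X Y)
    (n : nat) (N : network n) (x : (X ^ n)%type) (y : option Y) : Prop :=
  exists t' : nat, forall (i : 'I_n) (t : nat), t' <= t ->
    output (execution A N x t i) = y.

Definition computable_with_infinite_memory (X : finType) (Y : countType)
    (f : forall n : nat, (X ^ n)%type -> Y) : Prop :=
  exists A : algorithm X Y,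
    forall (n : nat) (N : network n) (x : (X ^ n)%type),
      terminates_with A N x (Some (f n x)).

Definition frequency (K n : nat) (x : ('I_K.+1 ^ n)%type) (k : 'I_K.+1) : rat :=
  (#|[set i | x i == k]|%:R / n%:R)%R.

Definition frequencies (K n : nat) (x : ('I_K.+1 ^ n)%type) :
    {ffun 'I_K.+1 -> rat} :=
  [ffun k => frequency x k].

(* Main.v *)
Require Import Defs.
From HB Require Import structures.
From mathcomp Require Import all_boot all_order all_algebra.
From mathcomp Require Import boolp.

(** In every round each node broadcasts one symbol, an input value or the special
symbol, to all its neighbors, and it keeps in memory everything that it has
received.  The schedule of the broadcasts makes the infinite stream of symbols
sent by a node encode its own input value, its degree, and the complete streams
of all its neighbors ([stream_code], [stream_neighbors]).  A finite alphabet
suffices for this because a node relays each symbol received from each neighbor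
separately, at a time of its own.

Hence the stream colouring is equitable: the colour of a node determines how many
neighbors of each colour it has.  Let N(a) be the size of the colour class a, and
D(a, b) the number of neighbors of colour b of a node of colour a.  Counting the
edges between two classes from both sides gives N(a) D(a, b) = N(b) D(b, a), so
the ratio N(b) / N(a) for adjacent classes depends on the colours only.  If two
connected graphs share a colour, they therefore have the same colours, and their
class sizes are proportional ([class_ratio_const]); in particular they have the
same frequencies of input values ([stream_frequencies]).

It remains to pass from infinite streams to finite times.  The finite connected
graphs with input values and a distinguished node form a countable set.  At time t
a node selects, among the t first of them, the earliest in which the distinguished
node has the input value and the received symbols of the node itself.  Each candidate that
differs from the node at some time is discarded for ever, so the choice
stabilizes ([first_candidate_stabilizes]), on a graph whose distinguished node
has the same infinite stream; its frequencies, which the node outputs, are then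
the right ones. *)

Set Implicit Arguments.
Unset Strict Implicit.
Unset Printing Implicit Defensive.

Import GRing.Theory Num.Theory.

(** * Connected graphs *)

(** Neighbors are listed rather than given by a relation, because the order of
the ports enters the broadcasts. *)
Definition connected_graph (T : finType) (nb : T -> seq T) : bool :=
  [&& [forall u, uniq (nb u)],
      [forall u, forall v, (u \in nb v) == (v \in nb u)] &
      [forall u, forall v, connect (grel nb) u v]].

Lemma connected_graphP (T : finType) (nb : T -> seq T) :
  reflect [/\ forall u, uniq (nb u), forall u v, (u \in nb v) = (v \in nb u)
            & forall u v, connect (grel nb) u v]
          (connected_graph nb).
Proof.
apply: (iffP and3P) => -[uniq_nb sym_nb conn_nb]; split.
- exact/forallP.
- by move=> u v; apply/eqP; move/forallP/(_ u)/forallP: sym_nb.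
- by move=> u v; move/forallP/(_ u)/forallP: conn_nb.
- exact/forallP.
- by apply/forallP => u; apply/forallP => v; apply/eqP.
- by apply/forallP => u; apply/forallP => v.
Qed.

Lemma connected_ind (T : finType) (nb : T -> seq T) (P : T -> Prop) (u0 : T) :
  connected_graph nb -> P u0 -> (forall u v, v \in nb u -> P u -> P v) ->
  forall v, P v.
Proof.
case/connected_graphP => _ _ conn_nb Pu0 step v.
case/connectP: (conn_nb u0 v) => p; elim: p u0 Pu0 => [|w p IHp] u Pu /=.
  by move=> _ ->.
by case/andP => /(step _ _)/(_ Pu) Pw; apply: IHp.
Qed.

(** * Equitable colourings *)

(** Two graphs are allowed, so that colours can be compared across networks; the
usual equitable partitions of a single graph are the case [nb' = nb], [c' = c]. *)
Definition equitable (C : eqType) (T T' : finType) (nb : T -> seq T)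
    (nb' : T' -> seq T') (c : T -> C) (c' : T' -> C) : Prop :=
  forall u u', c u = c' u' -> perm_eq (map c (nb u)) (map c' (nb' u')).

Definition class_size (C : eqType) (T : finType) (c : T -> C) (b : C) : nat :=
  #|[pred v | c v == b]|.

Lemma class_size_gt0 (C : eqType) (T : finType) (c : T -> C) (v : T) :
  0 < class_size c (c v).
Proof. by apply/card_gt0P; exists v; rewrite inE. Qed.

(** Both sides count the edges between the class of [u] and the class of [w], from
one end and from the other. *)
Lemma edges_between_classes (C : eqType) (T : finType) (nb : T -> seq T)
    (c : T -> C) (u w : T) :
  connected_graph nb -> equitable nb nb c c ->
  class_size c (c u) * count_mem (c w) (map c (nb u)) =
  class_size c (c w) * count_mem (c u) (map c (nb w)).
Proof.
case/connected_graphP => uniq_nb sym_nb _ eq_c.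
(* The number of edges from the class of [a] to the class [b], as a double sum
   in which the two ends can be exchanged. *)
have edgesE a b : class_size c (c a) * count_mem b (map c (nb a)) =
    \sum_(v | c v == c a) \sum_(z | c z == b) (z \in nb v).
  rewrite -sum_nat_const; apply: eq_bigr => v /eqP cv.
  rewrite (permP (eq_c _ _ (esym cv))) count_map -sum1_count big_mkcond.
  rewrite big_uniq //= [RHS]big_mkcond [LHS]big_mkcond.
  by apply: eq_bigr => z _; do 2?case: ifP.
rewrite !edgesE exchange_big; apply: eq_bigr => v _; apply: eq_bigr => z _.
by rewrite sym_nb.
Qed.

Section TwoGraphs.

Variables (C : eqType) (T T' : finType).
Variables (nb : T -> seq T) (nb' : T' -> seq T') (c : T -> C) (c' : T' -> C).
Hypotheses (graph_nb : connected_graph nb) (graph_nb' : connected_graph nb').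
Hypotheses (eq_c : equitable nb nb c c) (eq_c' : equitable nb' nb' c' c').
Hypothesis eq_cc' : equitable nb nb' c c'.

(** A shared colour spreads along the edges: a node with a counterpart of the same
colour has neighbors of the same colours as that counterpart. *)
Lemma class_met (u0 : T) (u0' : T') :
  c u0 = c' u0' -> forall v, exists v', c v = c' v'.
Proof.
move=> c0; apply: (connected_ind (u0 := u0) graph_nb); first by exists u0'.
move=> u v uv [u' cu]; have /perm_mem/(_ (c v)) := eq_cc' cu.
by rewrite map_f // => /esym/mapP[v' _ cv]; exists v'.
Qed.

Local Open Scope ring_scope.

Definition class_ratio (v : T) : rat :=
  (class_size c' (c v))%:R / (class_size c (c v))%:R.

(** For adjacent nodes, the edge counts in the two graphs involve the same numbers
of neighbors, and dividing one count by the other shows that the ratio is the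
same at both ends; connectedness does the rest. *)
Lemma class_ratio_const (u0 : T) (u0' : T') :
  c u0 = c' u0' -> forall v, class_ratio v = class_ratio u0.
Proof.
move=> c0; apply: (connected_ind (u0 := u0) graph_nb) => // u w uw <-.
have [u' cu] := class_met c0 u; have [w' cw] := class_met c0 w.
have edges := edges_between_classes u w graph_nb eq_c.
have edges' := edges_between_classes u' w' graph_nb' eq_c'.
rewrite -cu -cw -(permP (eq_cc' cu)) -(permP (eq_cc' cw)) in edges'.
have {}uw : (0 < count_mem (c w) (map c (nb u)))%N.
  by rewrite -has_count has_pred1 map_f.
move: (count_mem (c u) _) edges edges' uw => b.
move: (count_mem (c w) _) => a + + a_gt0.
move=> /(congr1 (fun m => m%:R : rat)) + /(congr1 (fun m => m%:R : rat)).
rewrite !natrM => edges edges'.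
have a0 : a%:R != 0 :> rat by rewrite pnatr_eq0 -lt0n.
have neq0 z : (class_size c (c z))%:R != 0 :> rat.
  by rewrite pnatr_eq0 -lt0n class_size_gt0.
apply/eqP; rewrite eqr_div //; apply/eqP/(mulIf a0).
by rewrite -mulrA edges mulrCA -edges' mulrCA mulrA.
Qed.

(** Each class of the second graph is [class_ratio u0] times as large as the class
of the same colour in the first, and its nodes all have counterparts there.  The
classes are summed without listing the colours: every node of the second graph
is counted as the sum of the weights 1 / [class_size] over its counterparts. *)
Lemma card_colour_class (P : pred C) (u0 : T) (u0' : T') :
  c u0 = c' u0' -> (forall v', exists v, c' v' = c v) ->
  #|[pred v' | P (c' v')]|%:R = class_ratio u0 * #|[pred v | P (c v)]|%:R.
Proof.
move=> c0 met'.
have cardE (U : finType) (Q : pred U) : #|Q|%:R = \sum_(v | Q v) 1 :> rat.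
  by rewrite -sum1_card natr_sum.
rewrite !cardE mulr_sumr /=.
transitivity (\sum_(v' | P (c' v')) \sum_(v | c v == c' v')
    ((class_size c (c v))%:R^-1 : rat)).
  apply: eq_bigr => v' _; have [v cv] := met' v'.
  rewrite (eq_bigr (fun=> (class_size c (c' v'))%:R^-1)); last by move=> z /eqP->.
  rewrite sumr_const -[_ *+ _]mulr_natr cv mulVf //.
  by rewrite pnatr_eq0 -lt0n class_size_gt0.
rewrite (exchange_big_dep (fun v => P (c v))) /=; last by move=> v' v + /eqP->.
apply: eq_bigr => v Pv; rewrite mulr1 -(class_ratio_const c0 v).
rewrite (eq_bigl [pred v' | c' v' == c v]); last first.
  by move=> v' /=; rewrite eq_sym; case: eqP => [->|]; rewrite ?Pv ?andbF.
by rewrite sumr_const -[LHS]mulr_natl.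
Qed.

End TwoGraphs.

(** With [P] true everywhere, [card_colour_class] says that the numbers of nodes
are in the same proportion as the sizes of the classes, so the factor cancels. *)
Lemma colour_frequency (C : eqType) (T T' : finType) (nb : T -> seq T)
    (nb' : T' -> seq T') (c : T -> C) (c' : T' -> C) (P : pred C)
    (u : T) (u' : T') :
  connected_graph nb -> connected_graph nb' ->
  equitable nb nb c c -> equitable nb' nb' c' c' -> equitable nb nb' c c' ->
  c u = c' u' ->
  (#|[pred v' | P (c' v')]|%:R / #|T'|%:R =
   #|[pred v | P (c v)]|%:R / #|T|%:R :> rat)%R.
Proof.
move=> gr gr' eq_c eq_c' eq_cc' cu.
have eq_c'c : equitable nb' nb c' c.
  by move=> v' v /esym/eq_cc'; rewrite perm_sym.
have met' := class_met gr' eq_c'c (esym cu).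
have card Q := card_colour_class gr gr' eq_c eq_c' eq_cc' Q cu met'.
rewrite card (card predT) -mulf_div divff ?mul1r //.
rewrite mulf_neq0 ?invr_eq0 // pnatr_eq0 -lt0n ?class_size_gt0 //.
by rewrite cu class_size_gt0.
Qed.

(** * Broadcast streams *)

(** The first symbol sent is the input value.  After 2 ^ k * 3 ^ m rows have been
received, entry k of row m is relayed, where rows are indexed by time and entries
by port.  If k is not smaller than the degree, [nth] returns the special symbol,
which reveals the degree to the neighbors. *)
Definition broadcast (X : Type) (x : X) (h : seq (seq (option X))) : option X :=
  if size h == 0 then Some x
  else nth None (nth [::] h (logn 3 (size h))) (logn 2 (size h)).

Fixpoint transcript (X T : Type) (nb : T -> seq T) (x : T -> X) (t : nat)
    (v : T) : seq (seq (option X)) :=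
  if t is t'.+1 then
    let h := transcript nb x t' in
    rcons (h v) [seq broadcast (x w) (h w) | w <- nb v]
  else [::].

Definition stream (X T : Type) (nb : T -> seq T) (x : T -> X) (v : T) (t : nat) :
    option X :=
  broadcast (x v) (transcript nb x t v).

Lemma transcriptE (X T : Type) (nb : T -> seq T) (x : T -> X) t v :
  transcript nb x t v =
  mkseq (fun m => [seq stream nb x w m | w <- nb v]) t.
Proof. by elim: t => //= t ->; rewrite mkseqS. Qed.

Lemma take_transcript (X T : Type) (nb : T -> seq T) (x : T -> X) s t v :
  s <= t -> take s (transcript nb x t v) = transcript nb x s v.
Proof.
by move=> le_st; rewrite !transcriptE /mkseq -map_take take_iota (minn_idPl le_st).
Qed.

Lemma stream_code (X T : Type) (nb : T -> seq T) (x : T -> X) v k m :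
  stream nb x v (2 ^ k * 3 ^ m) =
  nth None [seq stream nb x w m | w <- nb v] k.
Proof.
have pow_gt0 p i : 0 < p -> 0 < p ^ i by rewrite expn_gt0 => ->.
have lt_m : m < 2 ^ k * 3 ^ m.
  by apply: leq_trans (ltn_expl m (isT : 1 < 3)) _; rewrite leq_pmull ?pow_gt0.
rewrite {1}/stream /broadcast transcriptE size_mkseq eqn0Ngt (leq_trans _ lt_m) //=.
by rewrite !lognM ?pow_gt0 // !lognX !logn_prime //= !muln0 !muln1 addn0 nth_mkseq.
Qed.

(** At time 0 every node sends an input value, never the special symbol, so the
relayed entries of row 0 give the degree; once the degree is known, the relayed
entry k of all rows is the stream of the neighbor k. *)
Lemma stream_neighbors (X T T' : Type) (nb : T -> seq T) (nb' : T' -> seq T')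
    (x : T -> X) (x' : T' -> X) u u' :
  stream nb x u = stream nb' x' u' ->
  map (stream nb x) (nb u) = map (stream nb' x') (nb' u').
Proof.
move=> eq_s.
have eq_nth k m : nth None [seq stream nb x w m | w <- nb u] k =
    nth None [seq stream nb' x' w m | w <- nb' u'] k.
  by rewrite -!stream_code eq_s.
have eq_sz : size (nb u) = size (nb' u').
  apply/eqP; rewrite eqn_leq; apply/andP; split; rewrite leqNgt; apply/negP=> lt.
    have := eq_nth (size (nb' u')) 0; rewrite [RHS]nth_default ?size_map //.
    by case: (nb u) lt => // w s lt; rewrite (nth_map w).
  have := eq_nth (size (nb u)) 0; rewrite nth_default ?size_map //.
  by case: (nb' u') lt => // w s lt; rewrite (nth_map w).
apply: (@eq_from_nth _ (fun=> None)); rewrite ?size_map // => k ltk.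
apply/funext => m; have := eq_nth k m.
case: (nb u) (nb' u') ltk eq_sz => [|w s] [|w' s'] // ltk eq_sz.
by rewrite !(nth_map w) -?eq_sz // !(nth_map w') -?eq_sz.
Qed.

Lemma equitable_stream (X : eqType) (T T' : finType) (nb : T -> seq T)
    (nb' : T' -> seq T') (x : T -> X) (x' : T' -> X) :
  equitable nb nb' (stream nb x) (stream nb' x').
Proof. by move=> u u' eq_s; rewrite (stream_neighbors eq_s). Qed.

(** The input value is the first symbol of the stream, so it is a function of the
colour and [colour_frequency] applies. *)
Lemma stream_frequencies (K n n' : nat) (nb : 'I_n -> seq 'I_n)
    (nb' : 'I_n' -> seq 'I_n') (x : ('I_K.+1 ^ n)%type)
    (x' : ('I_K.+1 ^ n')%type) (u : 'I_n) (u' : 'I_n') :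
  connected_graph nb -> connected_graph nb' ->
  stream nb x u = stream nb' x' u' -> frequencies x = frequencies x'.
Proof.
move=> gr gr' eq_s; apply/ffunP => k; rewrite !ffunE /frequency.
have := colour_frequency (fun s : nat -> option 'I_K.+1 => s 0 == Some k) gr gr'
  (@equitable_stream _ _ _ _ _ _ _) (@equitable_stream _ _ _ _ _ _ _)
  (@equitable_stream _ _ _ _ _ _ _) eq_s.
by rewrite !card_ord !cardsE => ->.
Qed.

(** * Searching a countable set of candidates *)

Definition eventually (P : nat -> Prop) : Prop :=
  exists t0, forall t, t0 <= t -> P t.

Lemma eventually_forall (I : finType) (P : I -> nat -> Prop) :
  (forall i, eventually (P i)) -> eventually (fun t => forall i, P i t).
Proof.
case/fin_all_exists => t0 Pt0; exists (\max_i t0 i) => t le_t i.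
by apply: Pt0; apply: leq_trans le_t; apply: leq_bigmax.
Qed.

Definition first_candidate (T : countType) (Q : pred T) (t : nat) : option T :=
  ohead (filter Q (pmap unpickle (iota 0 t))).

(** Of the candidates that are never refuted, let [c] be the one of least code.
The finitely many codes below it are all refuted in the end. *)
Lemma first_candidate_stabilizes (T : countType) (Q : nat -> pred T) (c0 : T) :
  (forall s t c, s <= t -> Q t c -> Q s c) -> (forall t, Q t c0) ->
  exists2 c, forall t, Q t c &
    eventually (fun t => first_candidate (Q t) t = Some c).
Proof.
move=> anti Qc0.
pose good m := `[< exists2 c, unpickle m = Some c & forall t, Q t c >].
have ex_good : exists m, good m.
  by exists (pickle c0); apply/asboolP; exists c0; rewrite ?pickleK.
case: (ex_minnP ex_good) => m /asboolP[c mc Qc] min_m; exists c => //.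
have refuted (i : 'I_m) : eventually (fun t =>
    forall c', unpickle (i : nat) = Some c' -> ~~ Q t c').
  case ic: (unpickle (i : nat)) => [c'|]; last by exists 0.
  have [t0 nQ] : exists t0, ~~ Q t0 c'.
    apply: contrapT => noQ; have := min_m i; rewrite leqNgt ltn_ord => /implyP.
    rewrite implybF => /asboolP; apply; exists c' => // t.
    by apply/negPn/negP => nQ; apply: noQ; exists t.
  by exists t0 => t le_t _ [<-]; apply: contra nQ; apply: anti.
case: (eventually_forall refuted) => t0 early.
exists (maxn t0 m.+1) => t; rewrite geq_max => /andP[/early none_early lt_mt].
have -> : first_candidate (Q t) t =
    ohead (filter (Q t) (pmap unpickle (iota 0 m ++ iota m (t - m)))).
  by rewrite -[in iota m _](add0n m) -iotaD subnKC // ltnW.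
rewrite -(@prednK (t - m)) ?subn_gt0 // pmap_cat filter_cat /= mc /= Qc.
set s := filter _ _; have -> : s = [::]; last by [].
apply/eqP; rewrite -(negbK (_ == _)) -has_filter; apply/hasPn => c'.
rewrite mem_pmap => /mapP[i]; rewrite mem_iota /= add0n => lt_im ic'.
exact: none_early (Ordinal lt_im) _ (esym ic').
Qed.

(** * The algorithm *)

Section Algorithm.

Variable K : nat.
Let X : finType := 'I_K.+1.

Definition rooted_graph : countType :=
  {n : nat & ({ffun 'I_n -> seq 'I_n} * {ffun 'I_n -> X} * 'I_n)%type}.

Definition consistent (x : X) (h : seq (seq (option X))) (c : rooted_graph) :
    bool :=
  let: existT n (nb, y, v) := c in
  [&& connected_graph nb, y v == x & transcript nb y (size h) v == h].

Definition guess (x : X) (h : seq (seq (option X))) :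
    option {ffun X -> rat} :=
  omap (fun c : rooted_graph => let: existT n (nb, y, v) := c in frequencies y)
       (first_candidate (consistent x h) (size h)).

(** The messages of round 0 are all the special symbol and carry no information:
the empty memory [None] marks that round, and they are not recorded. *)
Definition frequency_step (d : nat)
    (s : state X (seq (seq (option X))) {ffun X -> rat} X d) :
    state X (seq (seq (option X))) {ffun X -> rat} X d :=
  let h := if memory s is Some h then rcons h (messages s) else [::] in
  State (input s) (Some h) (guess (input s) h)
        [tuple broadcast (input s) h | _ < d].

Definition frequency_algorithm : algorithm X {ffun X -> rat} :=
  @Algorithm X _ (fun=> seq (seq (option X))) X frequency_step
    (fun d s => erefl).

Definition network_graph (n : nat) (N : network n) (i : 'I_n) : seq 'I_n :=
  neighbors N i.

Lemma network_connected_graph (n : nat) (N : network n) :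
  connected_graph (network_graph N).
Proof.
apply/connected_graphP; split.
- by move=> u; rewrite sort_uniq enum_uniq.
- by move=> u v; rewrite !neighbor_edge edge_symmetric.
- move=> u v; rewrite (@eq_connect _ _ (edge N)) ?edge_connected // => i j.
  exact: neighbor_edge.
Qed.

(** Because a node sends the same symbol on all its edges, what it receives through
a port is determined by the node at the other end alone.  The broadcasts start
at the first update, so an execution is one round ahead of its transcripts. *)
Lemma executionE (n : nat) (N : network n) (x : (X ^ n)%type) t (i : 'I_n) :
  let h := transcript (network_graph N) x t i in
  execution frequency_algorithm N x t.+1 i =
  State (x i) (Some h) (guess (x i) h) [tuple broadcast (x i) h | _ < deg N i].
Proof.
elim: t i => [|t IHt] i //.
set S := execution frequency_algorithm N x t.+1 in IHt.
set received := [tuple nth None (messages (S (tnth (neighbors N i) k)))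
                           (position N (tnth (neighbors N i) k) i)
                 | k < deg N i].
have receivedE : received = [seq broadcast (x w)
    (transcript (network_graph N) x t w) | w <- network_graph N i] :> seq _.
  rewrite -[network_graph N i](map_tnth_enum (neighbors N i)) -map_comp.
  apply: eq_map => k; rewrite IHt [RHS]/=.
  by rewrite -(tnth_nth _ _ (Ordinal (position_lt k))) tnth_mktuple.
have -> : execution frequency_algorithm N x t.+2 i =
    frequency_step (State (x i) (memory (S i)) (output (S i)) received) by [].
by rewrite /frequency_step IHt [LHS]/= receivedE.
Qed.

(** The true network, rooted at [i], is a candidate that is never refuted; the
selected graph may be another one, but its root has the same stream as [i]. *)
Lemma guess_eventually (n : nat) (N : network n) (x : (X ^ n)%type) (i : 'I_n) :
  eventually (fun t =>
    guess (x i) (transcript (network_graph N) x t i) = Some (frequencies x)).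
Proof.
set G := network_graph N.
have size_tr t : size (transcript G x t i) = t.
  by rewrite transcriptE size_mkseq.
pose Q t := consistent (x i) (transcript G x t i).
have Q_anti s t c : s <= t -> Q t c -> Q s c.
  case: c => m [[nb y] v] le_st /and3P[gr y_v]; rewrite size_tr => /eqP eq_tr.
  apply/and3P; split; rewrite // size_tr -!(take_transcript _ _ _ le_st).
  by rewrite eq_tr.
have Q_self t : Q t (existT _ n ([ffun j => G j], x, i)).
  have fE : [ffun j => G j] = G :> (_ -> _) by apply/funext => j; rewrite ffunE.
  by rewrite /Q /consistent fE network_connected_graph !eqxx size_tr /=.
have [[m [[nb y] v]] Qc [t0 first_c]] := first_candidate_stabilizes Q_anti Q_self.
exists t0 => t /first_c; rewrite /guess size_tr /Q => -> /=; congr Some.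
have [/and3P[gr /eqP y_v _] graph_N] := (Qc 0, network_connected_graph N).
apply: (@stream_frequencies _ _ _ nb G _ _ v i) => //; apply/funext => s.
have /and3P[_ _ /eqP] := Qc s; rewrite size_tr => eq_tr.
by rewrite /stream eq_tr y_v.
Qed.

End Algorithm.

Theorem theorem4p5 (K : nat) :
  computable_with_infinite_memory (fun n : nat => @frequencies K n).
Proof.
exists (frequency_algorithm K) => n N x.
have [t0 guessed] := eventually_forall (guess_eventually N x).
exists t0.+1 => i [|t] // le_t; rewrite executionE /=.
exact: guessed.
Qed.
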